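(* Let $\ell\ge2$ and $n_1,\dots,n_\ell$ be positive integers such that at least two of them are odd, and suppose (after relabeling) that $n_1$ and $n_2$ are the two smallest odd numbers among $n_1,\dots,n_\ell$. Then $$\gamma_{\rm SMB}'(S(n_1,\dots,n_\ell))=\lceil \log_2(n_1+n_2+1)\rceil.$$
   Context: $S(n_1,\dots,n_\ell)$ is the subdivided star obtained from paths $P_{n_1},\dots,P_{n_\ell}$ and a new central vertex $x$ by making $x$ adjacent to one end of each path. The Maker-Breaker domination game on a finite simple graph $G$: Dominator and Staller alternately claim previously unclaimed vertices of $G$. Staller wins if she claims all vertices of the closed neighborhood $N_G[v]$ of some vertex $v$; otherwise Dominator wins. In the S-game Staller moves first. $\gamma_{\rm SMB}'(G)$ is the minimum number of moves Staller needs to win the S-game under optimal play (Staller minimizing the number of her moves, Dominator trying to prevent or delay her win), $\infty$ if Staller has no winning strategy. *)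

(* Defs.v *)
From mathcomp Require Import all_boot.

Set Implicit Arguments.
Unset Strict Implicit.
Unset Printing Implicit Defensive.

Record simple_graph := SimpleGraph {
  vertex :> finType;
  adj : rel vertex;
  adj_sym : symmetric adj;
  adj_irrefl : irreflexive adj
}.

Definition closed_nbhd (G : simple_graph) (v : G) : {set G} :=
  [set u | (u == v) || adj v u].

Section Game.

Variable G : simple_graph.

(* In a position, D and S are the sets of vertices claimed so far by Dominator
   and by Staller. *)

Definition unclaimed (D S : {set G}) : {set G} := ~: (D :|: S).

Definition staller_won (S : {set G}) : bool :=
  [exists v : G, closed_nbhd v \subset S].

(* Staller is to move and has not won yet; she can force a win within her next
   k moves.  If her move exhausts the vertices without her having won, then the
   game is over and Dominator has won, hence the nonemptiness condition. *)
Fixpoint staller_wins_within (k : nat) (D S : {set G}) : bool :=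
  if k is k'.+1 then
    [exists x in unclaimed D S,
       let S' := x |: S in
       staller_won S' ||
       ((unclaimed D S' != set0) &&
        [forall y in unclaimed D S', staller_wins_within k' (y |: D) S'])]
  else false.

(* None stands for infinity.  Staller makes at most #|G| moves, so the search
   may stop there; see gammaSMB'_Some and gammaSMB'_None. *)
Definition gammaSMB' : option nat :=
  ohead [seq k <- iota 0 #|G|.+1 | staller_wins_within k set0 set0].

Lemma staller_wins_within_unclaimed k D S :
  staller_wins_within k D S -> staller_wins_within #|unclaimed D S| D S.
Proof.
elim: k D S => [|k IHk] D S //= /existsP[x /andP[xU wx]].
have cU : #|unclaimed D S| = #|unclaimed D (x |: S)|.+1.
  rewrite (cardsD1 x) xU add1n; congr _.+1; apply: eq_card => z.
  by rewrite !inE; case: (z == x); case: (z \in D); case: (z \in S).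
rewrite cU /=; apply/existsP; exists x; rewrite xU /=.
case/orP: wx => [-> //|/andP[U0 /forallP wy]].
rewrite U0 /=; apply/orP; right; apply/forallP => y; apply/implyP => yU.
have {wy} := IHk _ _ (implyP (wy y) yU).
have -> // : #|unclaimed D (x |: S)| = #|unclaimed (y |: D) (x |: S)|.+1.
  rewrite (cardsD1 y) yU add1n; congr _.+1; apply: eq_card => z.
  by rewrite !inE; case: (z == y); case: (z == x); case: (z \in D).
have mono : forall m D' S', staller_wins_within m D' S' ->
    staller_wins_within m.+1 D' S'.
  elim=> [|m IHm] D' S' // /existsP[a /andP[aU wa]].
  apply/existsP; exists a; rewrite aU andTb.
  case/orP: wa => [wa|/andP[U1 wb]]; apply/orP; [by left | right].
  rewrite U1; apply/forallP => b; apply/implyP => bU.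
  exact/IHm/(implyP (forallP wb b) bU).
exact: mono.
Qed.

Lemma gammaSMB'_None :
  gammaSMB' = None <-> forall k, ~~ staller_wins_within k set0 set0.
Proof.
rewrite /gammaSMB'; split => [|nw]; last first.
  by rewrite (eq_filter (a2 := pred0)) ?filter_pred0 // => k; exact/negbTE/nw.
case E: [seq _ <- _ | _] => [|//] _ k; apply/negP => /staller_wins_within_unclaimed.
set m := #|_| => wm; have: m \in [seq k <- iota 0 #|G|.+1 |
  staller_wins_within k set0 set0] by rewrite mem_filter wm mem_iota ltnS max_card.
by rewrite E.
Qed.

Lemma gammaSMB'_Some k :
  gammaSMB' = Some k <->
  staller_wins_within k set0 set0 /\
  forall m, staller_wins_within m set0 set0 -> k <= m.
Proof.
have fwd j : gammaSMB' = Some j -> staller_wins_within j set0 set0 /\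
    forall m, staller_wins_within m set0 set0 -> j <= m.
  rewrite /gammaSMB'; case E: [seq _ <- _ | _] => [//|a s] [<-].
  have st : sorted leq (a :: s).
    by rewrite -E sorted_filter ?iota_sorted //; apply: leq_trans.
  have: a \in a :: s by rewrite mem_head.
  rewrite -E mem_filter mem_iota => /andP[wa lta]; split=> // m wm.
  case: (leqP m #|G|) => [mG|/ltnW]; last exact: leq_trans.
  have: m \in a :: s by rewrite -E mem_filter wm mem_iota.
  rewrite inE => /orP[/eqP-> //|ms].
  by move: st => /= /(order_path_min leq_trans)/allP; apply.
split=> [/fwd //|[wk mk]]; case E: gammaSMB' => [j|].
  have [wj mj] := fwd _ E; congr Some.
  by apply/eqP; rewrite eqn_leq mj ?mk.
by have := gammaSMB'_None.1 E k; rewrite wk.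
Qed.

End Game.

Section SubdividedStar.

Variables (l : nat) (n : 'I_l -> nat).

(* None is the centre; Some (Tagged _ j) with j : 'I_(n i) is the vertex number
   j, counted from the centre, of the i-th path. *)
Definition sstar_vertex : finType := option {i : 'I_l & 'I_(n i)}.

Definition sstar_adj (u v : sstar_vertex) : bool :=
  match u, v with
  | None, None => false
  | None, Some q => val (tagged q) == 0
  | Some p, None => val (tagged p) == 0
  | Some p, Some q =>
      (tag p == tag q) &&
      (((val (tagged p)).+1 == val (tagged q)) ||
       ((val (tagged q)).+1 == val (tagged p)))
  end.

Lemma sstar_adj_sym : symmetric sstar_adj.
Proof. by move=> [p|] [q|] //=; rewrite eq_sym orbC. Qed.

Lemma sstar_adj_irrefl : irreflexive sstar_adj.
Proof. by move=> [p|] //=; rewrite eqxx orbb eqn_leq ltnn. Qed.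

Definition subdivided_star : simple_graph :=
  SimpleGraph sstar_adj_sym sstar_adj_irrefl.

End SubdividedStar.

(* Main.v *)
(* Upper bound: legs [i1] and [i2] together with the centre form a path with an
   odd number m of vertices, and the centre has an even position on it (counted
   from 1).  Staller claims an even position near the middle; Dominator can
   answer in only one of the two odd subpaths, and Staller goes on in the
   other.  She never needs the neighbourhood of an even position, so the other
   legs do not matter, and k moves suffice as soon as m < 2^k.

   Lower bound: Dominator keeps the closed neighbourhoods that he has not hit
   yet inside a disjoint union of paths and at most one star.  After Staller's
   move he claims a vertex next to hers, or the centre, or the first vertex of
   the shortest odd leg, in such a way that, with k moves of Staller remaining,
   every odd path has at least 2^k vertices, any two odd legs of the star have
   together at least 2^k vertices, and the star has an odd leg.  (A star all of
   whose legs are even would be lost for Dominator.) *)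
Require Import Defs.
From mathcomp Require Import all_boot zify.

Set Implicit Arguments.
Unset Strict Implicit.
Unset Printing Implicit Defensive.

(** * The Maker-Breaker game on a hypergraph, with Dominator as Breaker *)

Section Hypergraph.

Variable T : eqType.
Implicit Types (x z c : T) (y : option T) (e g s t l r : seq T).
Implicit Types (F G : seq (seq T)) (L : seq (seq T)).

Definition hit y e : bool := if y is Some z then z \in e else false.

(* An edge lists the vertices that Staller still needs.  Staller claims [x],
   Dominator answers with [y], where [None] is a pass. *)
Definition play x y F : seq (seq T) :=
  [seq filter (predC1 x) e | e <- F & ~~ hit y e].

(** Dominator survives [k] further moves of Staller. Claimed vertices need no record: they occur in
    no remaining edge, so replaying one amounts to a pass. Only [x] itself must be barred as an
    answer, since [play] deletes the edges hit by [y] before it removes [x]. *)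
Fixpoint safe k F : Prop :=
  [::] \notin F /\
  if k is k'.+1 then
    forall x, exists2 y, y != Some x & safe k' (play x y F)
  else True.

(** [G] is at least as hard for Dominator as what [y] leaves of [F]; with [y = None] this compares
    two hypergraphs. *)
Definition covers y F G : Prop :=
  forall e, e \in F -> hit y e \/ exists2 g, g \in G & {subset g <= e}.

Lemma hit_subset y e g : {subset g <= e} -> hit y g -> hit y e.
Proof. by case: y => //= z; apply. Qed.

Lemma mem_play x y F e :
  e \in F -> ~~ hit y e -> filter (predC1 x) e \in play x y F.
Proof. by move=> eF ye; apply/map_f; rewrite mem_filter ye. Qed.

Lemma safe_nonempty k F : safe k F -> [::] \notin F.
Proof. by case: k => [|k] []. Qed.

Lemma nil_subset e : {subset e <= [::]} -> e = [::].
Proof. by case: e => // a e /(_ a (mem_head _ _)). Qed.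

Lemma covers_nonempty F G : covers None F G -> [::] \notin G -> [::] \notin F.
Proof.
move=> FG; apply: contraNN => /FG[//|[g gG /nil_subset g0]].
by rewrite -g0.
Qed.

(** Dominator answers in [F] as he would in [G]: a vertex that hits an edge of [G] hits every edge
    containing it. *)
Lemma safe_covers k F G : covers None F G -> safe k G -> safe k F.
Proof.
elim: k F G => [|k IHk] F G FG [G0 Gk]; split=> //;
  try exact: covers_nonempty FG G0.
move=> x; have [y yx Gy] := Gk x; exists y => //.
apply: IHk Gy => _ /mapP[e + ->]; rewrite mem_filter => /andP[ye eF].
have [//|[g gG ge]] := FG e eF; right.
exists (filter (predC1 x) g).
  by apply: mem_play => //; apply: contraNN ye; apply: hit_subset.
by move=> a; rewrite !mem_filter => /andP[-> /ge].
Qed.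

(** The form in which every strategy below is given. Since [G] avoids [x], its edges stay inside
    those of [F] after Staller has taken [x]. *)
Lemma safe_step k F :
  [::] \notin F ->
  (forall x, exists y G, [/\ y != Some x, safe k G,
     {in G, forall g, x \notin g} & covers y F G]) ->
  safe k.+1 F.
Proof.
move=> F0 FS; split=> // x; have [y [G [yx Gk xG FG]]] := FS x; exists y => //.
apply: safe_covers Gk => _ /mapP[e + ->]; rewrite mem_filter => /andP[ye eF].
have [yE|[g gG ge]] := FG e eF; first by rewrite yE in ye.
right; exists g => // a ag; rewrite mem_filter ge //= andbT.
by apply: contraNneq (xG g gG) => <-.
Qed.

Lemma safe_nil k : safe k [::].
Proof. by elim: k => [|k IHk]; split=> // x; exists None. Qed.

Lemma safeW k F : safe k.+1 F -> safe k F.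
Proof.
elim: k F => [|k IHk] F [F0 Fk]; split=> // x.
by have [y yx Fy] := Fk x; exists y => //; apply: IHk.
Qed.

Definition disjoint_edges F G : Prop :=
  {in F & G, forall e g a, a \in e -> a \notin g}.

Lemma coversW y F G : covers None F G -> covers y F G.
Proof. by move=> FG e /FG[//|]; right. Qed.

Lemma covers_refl y F : covers y F F.
Proof. by move=> e eF; right; exists e. Qed.

Lemma covers_catl y F1 F2 G :
  covers y F1 G -> covers y F2 G -> covers y (F1 ++ F2) G.
Proof. by move=> c1 c2 e; rewrite mem_cat => /orP[/c1|/c2]. Qed.

Lemma covers_catr1 y F G1 G2 : covers y F G1 -> covers y F (G1 ++ G2).
Proof.
move=> FG e /FG[|[g gG ge]]; [by left | right; exists g => //].
by rewrite mem_cat gG.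
Qed.

Lemma covers_catr2 y F G1 G2 : covers y F G2 -> covers y F (G1 ++ G2).
Proof.
move=> FG e /FG[|[g gG ge]]; [by left | right; exists g => //].
by rewrite mem_cat gG orbT.
Qed.

(** Staller's vertex meets at most one of the two sides. Dominator answers on that side, and the
    other side merely has one round fewer to survive. *)
Lemma safe_cat k F G :
  disjoint_edges F G -> safe k F -> safe k G -> safe k (F ++ G).
Proof.
elim: k F G => [|k IHk] F G FG sF sG.
  by split=> //; rewrite mem_cat negb_or sF.1 sG.1.
split=> [|x]; first by rewrite mem_cat negb_or sF.1 sG.1.
have play_sub y H e : e \in play x y H -> exists2 h, h \in H & {subset e <= h}.
  case/mapP=> h; rewrite mem_filter => /andP[_ hH] ->.
  by exists h => // a; rewrite mem_filter => /andP[].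
have play_away y (H : seq (seq T)) : {in H, forall h, x \notin h} ->
  covers None (play x y H) H.
  move=> xH _ /mapP[h + ->]; rewrite mem_filter => /andP[_ hH]; right.
  exists h => // a ah; rewrite mem_filter ah andbT /=.
  by apply: contraNneq (xH h hH) => <-.
have FG' y : disjoint_edges (play x y F) (play x y G).
  move=> e g /play_sub[e' eF ee] /play_sub[g' gG gg] a /ee ae.
  by apply: contraNN (FG _ _ eF gG a ae); apply: gg.
have playE y : play x y (F ++ G) = play x y F ++ play x y G.
  by rewrite /play filter_cat map_cat.
have [/hasP[e eF xe]|/hasPn xF] := boolP (has (fun e => x \in e) F).
  have [y yx sy] := sF.2 x; exists y => //; rewrite playE; apply: IHk => //.
  apply: safe_covers (safeW sG); apply: play_away => g gG.
  exact: (FG _ _ eF gG).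
have [y yx sy] := sG.2 x; exists y => //; rewrite playE; apply: IHk => //.
by apply: safe_covers (safeW sF); apply: play_away.
Qed.

(** * Closed neighbourhoods in paths *)

(* Closed neighbourhoods of the vertices of [s] in the path [l ++ s ++ r], where
   [l] has at most one vertex and only the head of [r] matters. *)
Fixpoint nbhds l s r : seq (seq T) :=
  if s is a :: s' then (l ++ a :: take 1 (s' ++ r)) :: nbhds [:: a] s' r
  else [::].

Lemma nil_nbhds l s r : [::] \notin nbhds l s r.
Proof. by elim: s l => //= a s IHs l; rewrite inE negb_or IHs; case: l. Qed.

Lemma mem_nbhds l s r e a : e \in nbhds l s r -> a \in e -> a \in l ++ s ++ r.
Proof.
elim: s l => //= b s IHs l; rewrite inE => /orP[/eqP->|/IHs {}IHs].
  rewrite !(mem_cat, inE) => /or3P[->//|->|/mem_take]; rewrite ?orbT //.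
  by rewrite mem_cat => /orP[] ->; rewrite !orbT.
by move/IHs; rewrite !(mem_cat, inE) => ->; rewrite orbT.
Qed.

Lemma nbhds_cat l s1 s2 r :
  nbhds l (s1 ++ s2) r =
  nbhds l s1 (take 1 (s2 ++ r)) ++
  nbhds (if s1 is a :: s' then [:: last a s'] else l) s2 r.
Proof.
elim: s1 l => //= a s1 IHs l; rewrite IHs; congr ((_ ++ _ :: _) :: _).
  by case: s1 {IHs} => [|b s1] /=; rewrite ?take_takel // !take0.
by case: s1 {IHs}.
Qed.

(** The borders [l] and [r] enter only the outermost edges, and smaller edges are harder for
    Dominator. *)
Lemma nbhds_shrink y l l' s r r' : {subset l' <= l} ->
  {subset take 1 r' <= take 1 r} ->
  covers y (nbhds l s r) (nbhds l' s r').
Proof.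
move=> ll rr; apply: coversW.
elim: s l l' ll => [|a s IHs] l l' ll //= e; rewrite inE => /orP[/eqP->|eN];
  right.
  exists (l' ++ a :: take 1 (s ++ r')); first exact: mem_head.
  move=> b; rewrite !mem_cat !inE => /orP[/ll->//|/orP[->|]]; rewrite ?orbT //.
  by case: s {IHs} => [/rr|? ?] /=; rewrite ?take0 => ->; rewrite !orbT.
have [//|[g gN ge]] := IHs [:: a] [:: a] (fun _ => id) e eN.
by exists g => //; rewrite inE gN orbT.
Qed.

Lemma nbhds_head l z s r : covers (Some z) (nbhds l (z :: s) r) (nbhds [::] s
  r).
Proof.
move=> e; rewrite [nbhds _ _ _]/= inE => /orP[/eqP->|].
  by left=> /=; rewrite mem_cat mem_head orbT.
by apply: nbhds_shrink.
Qed.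

(** [z] also lies in the neighbourhood of its successor, so Dominator may drop two vertices instead
    of one. This freedom lets him choose the parity of what remains. *)
Lemma nbhds_head2 l z s r :
  covers (Some z) (nbhds l (z :: s) r) (nbhds [::] (behead s) r).
Proof.
case: s => [|b s]; first exact: nbhds_head.
move=> e; rewrite [nbhds _ _ _]/= !inE => /or3P[/eqP->|/eqP->|].
- by left=> /=; rewrite mem_cat mem_head orbT.
- by left=> /=; rewrite mem_head.
- by apply: nbhds_shrink.
Qed.

Lemma nbhds_last l z s r : covers (Some z) (nbhds l (rcons s z) r) (nbhds l s
  [::]).
Proof.
rewrite -cats1 nbhds_cat; apply: covers_catl; first exact: nbhds_shrink.
by move=> e; rewrite inE => /eqP->; left; rewrite /= mem_cat mem_head orbT.
Qed.

Lemma nbhds_last2 l z b s r :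
  covers (Some z) (nbhds l (rcons (rcons s b) z) r) (nbhds l s [::]).
Proof.
rewrite -cats1 nbhds_cat; apply: covers_catl.
  rewrite -cats1 nbhds_cat; apply: covers_catl; first exact: nbhds_shrink.
  move=> e; rewrite inE => /eqP->; left.
  by rewrite /= mem_cat !inE /= take0 eqxx !orbT.
by move=> e; rewrite inE => /eqP->; left; rewrite /= mem_cat mem_head orbT.
Qed.

(** Used with [x] taken by Staller. Dominator's [z] is next to [x], so it hits the neighbourhood of
    [x], the only one centred between the two parts. *)
Lemma nbhds_split z l s1 x s2 r G1 G2 :
  covers (Some z) (nbhds l s1 [:: x]) G1 ->
  covers (Some z) (nbhds [:: x] s2 r) G2 ->
  (exists s, s1 = rcons s z) \/ (exists s, s2 = z :: s) ->
  covers (Some z) (nbhds l (s1 ++ x :: s2) r) (G1 ++ G2).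
Proof.
move=> c1 c2 hz; rewrite nbhds_cat; apply: covers_catl.
  by rewrite /= take0; apply: covers_catr1.
move=> e; rewrite [nbhds _ (_ :: _) _]/= inE => /orP[/eqP->|].
  2: by apply: covers_catr2.
left=> /=; case: hz => -[s ->]; rewrite mem_cat.
  by case: s => [|a s] /=; rewrite ?last_rcons mem_head.
by rewrite /= !inE take0 eqxx !orbT.
Qed.

Lemma nbhds_split_right z l s1 x s2 r :
  covers (Some z) (nbhds l (s1 ++ x :: z :: s2) r)
    (nbhds l s1 [::] ++ nbhds [::] s2 r).
Proof.
apply: nbhds_split; [exact: nbhds_shrink | exact: nbhds_head |].
by right; exists s2.
Qed.

Lemma nbhds_split_right2 z l s1 x s2 r :
  covers (Some z) (nbhds l (s1 ++ x :: z :: s2) r)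
    (nbhds l s1 [::] ++ nbhds [::] (behead s2) r).
Proof.
apply: nbhds_split; [exact: nbhds_shrink | exact: nbhds_head2 |].
by right; exists s2.
Qed.

Lemma nbhds_split_left z l s1 x s2 r :
  covers (Some z) (nbhds l (rcons s1 z ++ x :: s2) r)
    (nbhds l s1 [::] ++ nbhds [::] s2 r).
Proof.
apply: nbhds_split; [exact: nbhds_last | exact: nbhds_shrink |].
by left; exists s1.
Qed.

Lemma nbhds_split_left2 z b l s1 x s2 r :
  covers (Some z) (nbhds l (rcons (rcons s1 b) z ++ x :: s2) r)
    (nbhds l s1 [::] ++ nbhds [::] s2 r).
Proof.
apply: nbhds_split; [exact: nbhds_last2 | exact: nbhds_shrink |].
by left; exists (rcons s1 b).
Qed.

Definition path_nbhds s := nbhds [::] s [::].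

Lemma mem_path_nbhds s e a : e \in path_nbhds s -> a \in e -> a \in s.
Proof. by move=> eN /(mem_nbhds eN); rewrite /= cats0. Qed.

Lemma disjoint_path_nbhds s1 s2 :
  ~~ has (mem s1) s2 -> disjoint_edges (path_nbhds s1) (path_nbhds s2).
Proof.
move=> /hasPn s12 e g eN gN a /(mem_path_nbhds eN) a1.
by apply/negP => /(mem_path_nbhds gN)/s12; rewrite /= a1.
Qed.

(** Dominator claims a vertex next to [x], dropping one vertex of an odd part or two of an even one,
    so that this part becomes even. An odd path remains only if both parts were odd. *)
Lemma safe_path k s :
  uniq s -> odd (size s) ==> (2 ^ k <= size s) -> safe k (path_nbhds s).
Proof.
elim: k s => [|k IHk] s us hs; first by split=> //; apply: nil_nbhds.
apply: safe_step => [|x]; first exact: nil_nbhds.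
have [xs|xs] := boolP (x \in s); last first.
  exists None, (path_nbhds s); split=> //; last exact: covers_refl.
    apply: IHk => //; apply: contraTT hs; rewrite expnS; lia.
  by move=> g gN; apply: contraNN xs; apply: mem_path_nbhds.
move: us hs; case/splitPr: xs => s1 s2 us hs.
have fin z t1 t2 : subseq t1 s1 -> subseq t2 s2 -> z \in s1 ++ s2 ->
    odd (size t1) ==> (2 ^ k <= size t1) ->
    odd (size t2) ==> (2 ^ k <= size t2) ->
    covers (Some z) (path_nbhds (s1 ++ x :: s2))
      (path_nbhds t1 ++ path_nbhds t2) ->
    exists y G, [/\ y != Some x, safe k G, {in G, forall g, x \notin g} &
      covers y (path_nbhds (s1 ++ x :: s2)) G].
  move=> ts1 ts2 zs h1 h2 hc; exists (Some z), (path_nbhds t1 ++ path_nbhds t2).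
  have : uniq (t1 ++ x :: t2).
    by apply: subseq_uniq us; apply: cat_subseq => //=; rewrite eqxx.
  rewrite cat_uniq /= negb_or => /and3P[u1 /andP[x1 t12] /andP[x2 u2]].
  split=> //.
  - apply: contraTneq zs => -[->]; move: us.
    rewrite cat_uniq mem_cat /= !negb_or => /and3P[_ /andP[xs1 _] /andP[xs2 _]].
    by rewrite xs1.
  - by apply: safe_cat; [exact: disjoint_path_nbhds | exact: IHk | exact: IHk].
  - move=> g; rewrite mem_cat => /orP[] /mem_path_nbhds gN.
      by apply: contraNN x1 => /gN.
    by apply: contraNN x2 => /gN.
have e2k : 2 ^ k.+1 = 2 * 2 ^ k by rewrite expnS.
rewrite size_cat /= {}e2k in hs.
have [o1|e1] := boolP (odd (size s1)); have [o2|e2] := boolP (odd (size s2)).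
- case/lastP: s1 => [//|s1 a] in us hs fin o1 *; rewrite size_rcons /= in hs o1.
  case: s2 => [//|b s2] in us hs fin o2 *; rewrite /= in hs o2.
  (* The shorter part is made even; the longer one has at least half of the [2 ^ k.+1] vertices,
     rounding being absorbed by [x]. *)
  have [le12|lt21] := leqP (size s1) (size s2).
    apply: (fin a s1 (b :: s2));
      rewrite ?subseq_refl ?subseq_rcons ?mem_cat ?mem_rcons ?mem_head //=;
        try lia.
    exact: nbhds_split_left.
  apply: (fin b (rcons s1 a) s2);
    rewrite ?subseq_refl ?subseq_cons ?mem_cat ?mem_head ?orbT ?size_rcons //=;
      try lia.
  exact: nbhds_split_right.
- case/lastP: s1 => [//|s1 a] in us hs fin o1 *; rewrite size_rcons /= in hs o1.
  apply: (fin a s1 s2);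
    rewrite ?subseq_refl ?subseq_rcons ?mem_cat ?mem_rcons ?mem_head //=;
      try lia.
  exact: nbhds_split_left.
- case: s2 => [//|b s2] in us hs fin o2 *; rewrite /= in hs o2.
  apply: (fin b s1 s2);
    rewrite ?subseq_refl ?subseq_cons ?mem_cat ?mem_head ?orbT //=; try lia.
  exact: nbhds_split_right.
(* Both parts are even, so the path is odd. They cannot both be empty, as the path would then have a
   single vertex, fewer than [2 ^ k.+1]. *)
- case: s2 => [|b s2] in us hs fin e2 *.
    case/lastP: s1 => [|s1 a] in us hs fin e1 *.
      by move: hs (expn_gt0 2 k) => /=; lia.
    case/lastP: s1 => [|s1 b] in us hs fin e1 *; first by [].
    rewrite !size_rcons /= in hs e1.
    apply: (fin a s1 [::]); rewrite ?mem_cat ?mem_rcons ?mem_head //=; try lia.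
      by rewrite -!cats1 -catA; apply: prefix_subseq.
    exact: nbhds_split_left2.
  apply: (fin b s1 (behead s2));
    rewrite ?subseq_refl ?mem_cat ?mem_head ?orbT //=; try lia.
  - by case: s2 {us hs fin e2} => //= c s2;
      apply: subseq_trans (subseq_cons _ _) (subseq_cons _ _).
  - by case: s2 e2 {us hs fin} => //= c s2; lia.
  exact: nbhds_split_right2.
Qed.

Lemma safe_paths k L :
  uniq (flatten L) ->
  all (fun s => odd (size s) ==> (2 ^ k <= size s)) L ->
  safe k (flatten [seq path_nbhds s | s <- L]).
Proof.
elim: L => [|s L IHL] /=; first by move=> _ _; apply: safe_nil.
rewrite cat_uniq => /and3P[us sL uL] /andP[hs hL].
apply: safe_cat; [move=> e g eN | exact: safe_path | exact: IHL].
move=> /flattenP[_ /mapP[t tL ->] gN] a /(mem_path_nbhds eN) ae.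
apply: contraNN sL => /(mem_path_nbhds gN) at_; apply/hasP; exists a => //.
by apply/flattenP; exists t.
Qed.

(** * Closed neighbourhoods in stars of paths *)

Definition star_nbhds c L : seq (seq T) :=
  (c :: flatten [seq take 1 s | s <- L]) ::
  flatten [seq nbhds [:: c] s [::] | s <- L].

Lemma nil_star_nbhds c L : [::] \notin star_nbhds c L.
Proof.
rewrite inE negb_or /=; apply/negP => /flattenP[_ /mapP[s _ ->]].
exact/negP/nil_nbhds.
Qed.

Lemma mem_star_nbhds c L e a :
  e \in star_nbhds c L -> a \in e -> a \in c :: flatten L.
Proof.
rewrite inE => /orP[/eqP->|/flattenP[_ /mapP[s sL ->] eN]].
  rewrite !inE => /orP[->//|/flattenP[_ /mapP[s sL ->]] /mem_take as_].
  by apply/orP; right; apply/flattenP; exists s.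
move=> /(mem_nbhds eN); rewrite /= cats0 !inE => /orP[->//|as_].
by apply/orP; right; apply/flattenP; exists s.
Qed.

Lemma covers_trans y F G H : covers None F G -> covers y G H -> covers y F H.
Proof.
move=> FG GH e /FG[//|[g /GH[yg|[h hH hg]] ge]]; first by left;
  apply: hit_subset yg.
by right; exists h => // a /hg/ge.
Qed.

Lemma perm_star_nbhds c L L' :
  perm_eq L L' -> covers None (star_nbhds c L) (star_nbhds c L').
Proof.
move=> pL; have mL := perm_mem pL.
have flt (U : eqType) (f : seq T ->
  seq U) : flatten [seq f s | s <- L] =i flatten [seq f s | s <- L'].
  by apply: perm_mem; apply: perm_flatten; apply: perm_map.
move=> e; rewrite inE => /orP[/eqP->|eN]; right.
  exists (c :: flatten [seq take 1 s | s <- L']); first exact: mem_head.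
  by move=> a; rewrite !inE flt.
by exists e => //; rewrite inE -flt eN orbT.
Qed.

Definition far k s t : bool :=
  odd (size s) && odd (size t) ==> (2 ^ k <= size s + size t).

Lemma pairwise_front (r : rel (seq T)) L1 s L2 :
  symmetric r -> pairwise r (L1 ++ s :: L2) -> pairwise r (s :: L1 ++ L2).
Proof.
move=> rC; rewrite !(pairwise_cat, pairwise_cons) /= allrel_consr all_cat.
case/and3P=> /andP[s1 ->] -> /andP[-> ->]; rewrite !andbT.
by apply: sub_all s1 => t; rewrite rC.
Qed.

Lemma far_sym k : symmetric (far k).
Proof. by move=> s t; rewrite /far andbC addnC. Qed.

Definition spread k L : bool :=
  has (fun s => odd (size s)) L && pairwise (far k) L.

Lemma spreadW k L : spread k.+1 L -> spread k L.
Proof.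
case/andP=> oL fL; rewrite /spread oL; apply: sub_pairwise fL => s t.
rewrite /far expnS => /implyP h; apply/implyP => /h; lia.
Qed.

Lemma spread_front k L s : s \in L -> spread k L ->
  exists2 L', perm_eq L (s :: L') & spread k (s :: L').
Proof.
case/splitPr=> L1 L2 /andP[oL fL]; exists (L1 ++ L2);
  first by rewrite perm_catC /= perm_cons perm_catC.
by rewrite /spread pairwise_front ?andbT //; [move: oL;
  rewrite !has_cat /= has_cat orbCA | apply: far_sym].
Qed.

(** For a leg cut at Staller's vertex: [s'] is the part still attached to the centre, [H] comes from
    the detached part. The condition on heads keeps the edge of the centre from growing. *)
Lemma star_nbhds_leg y c s s' L H :
  {subset take 1 s' <= take 1 s} ->
  covers y (nbhds [:: c] s [::]) (nbhds [:: c] s' [::] ++ H) ->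
  covers y (star_nbhds c (s :: L)) (star_nbhds c (s' :: L) ++ H).
Proof.
move=> ss hc e; rewrite inE => /orP[/eqP->|].
  right; exists (c :: take 1 s' ++ flatten [seq take 1 t | t <- L]).
    by rewrite inE eqxx.
  by move=> a /=; rewrite !(inE, mem_cat) => /or3P[->|/ss->|->]; rewrite ?orbT.
rewrite /= mem_cat => /orP[/hc[|[g gN ge]]|eN]; first by left.
  right; exists g => //; rewrite !(inE, mem_cat).
  by move: gN; rewrite mem_cat => /orP[] ->; rewrite ?orbT.
by right; exists e => //; rewrite !(inE, mem_cat) eN !orbT.
Qed.

(** Once the edge of the centre is hit, the legs can be treated separately. *)
Lemma star_nbhds_center y c L F :
  hit y (c :: flatten [seq take 1 s | s <- L]) ->
  (forall s, s \in L -> covers y (nbhds [:: c] s [::]) F) ->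
  covers y (star_nbhds c L) F.
Proof.
move=> hy hL e; rewrite inE => /orP[/eqP->|/flattenP[_ /mapP[s sL ->] eN]];
  first by left.
exact: hL eN.
Qed.

Lemma covers_flatten y F L s :
  s \in L -> covers y F (path_nbhds s) ->
  covers y F (flatten [seq path_nbhds s | s <- L]).
Proof.
move=> sL FG e /FG[|[g gN ge]]; first by left.
by right; exists g => //; apply/flattenP; exists (path_nbhds s) => //;
  apply: map_f.
Qed.

(** Dominator's answer leaves paths safe by [safe_path] and at most one star that is still
    [spread k]. If [x] lies on a leg, the cases follow the parities of its inner part [s1] and its
    outer part [s2]. *)
Lemma safe_star k c L :
  uniq (c :: flatten L) -> spread k L -> safe k (star_nbhds c L).
Proof.
elim: k c L => [|k IHk] c L uL hL; first by split=> //; apply: nil_star_nbhds.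
apply: safe_step => [|x]; first exact: nil_star_nbhds.
have front s : s \in L ->
  exists2 L', uniq (c :: s ++ flatten L') /\ spread k.+1 (s :: L')
    & (forall y G, covers y (star_nbhds c (s :: L')) G ->
      covers y (star_nbhds c L) G) /\ perm_eq L (s :: L').
  move=> sL; have [L' pL hL'] := spread_front sL hL; exists L'; split=> //.
    by move: uL;
      rewrite /= (perm_mem (perm_flatten pL)) (perm_uniq (perm_flatten pL)).
  by move=> y G; apply: covers_trans; apply: perm_star_nbhds.
have [xL|xL] := boolP (x \in c :: flatten L); last first.
  exists None, (star_nbhds c L); split=> //; last exact: covers_refl.
    exact/IHk/spreadW.
  by move=> g gN; apply: contraNN xL; apply: mem_star_nbhds.
move: xL; rewrite inE => /orP[/eqP->|/flattenP[s sL xs]].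
  (* Staller took the centre; Dominator takes the first vertex of a shortest odd leg, making it
     even. Any other odd leg is at least as long, hence has at least half of [2 ^ k.+1] vertices. *)
  have [s sL [os smin]] : exists2 s, s \in L &
      odd (size s) /\ forall t, t \in L -> odd (size t) -> size s <= size t.
    have exm : exists m, has (fun s => odd (size s) && (size s == m)) L.
      case/andP: hL => /hasP[s sL os] _; exists (size s).
      by apply/hasP; exists s; rewrite ?os ?eqxx.
    case: (ex_minnP exm) => m /hasP[s sL /andP[os /eqP sm]] mmin.
    exists s => //; split=> // t tL ot; rewrite sm; apply: mmin.
    by apply/hasP; exists t; rewrite ?ot ?eqxx.
  have [L' [uL' hL'] [cL' pL]] := front s sL.
  case: s => [//|z s] in sL os smin uL' hL' cL' pL *.
  exists (Some z), (flatten [seq path_nbhds t | t <- s :: L']).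
  move: uL'; rewrite [_ ++ _]/= !cons_uniq inE negb_or eq_sym.
  case/and3P=> /andP[zc cN] zN uL'; split=> //.
  - apply: safe_paths => //=; apply/andP; split; first by move: os => /=; lia.
    apply/allP => t tL; apply/implyP => ot.
    have szt : size (z :: s) <= size t.
      by apply: smin => //; rewrite (perm_mem pL) inE tL orbT.
    case/andP: hL' => _; rewrite pairwise_cons => /andP[/allP/(_ t tL)].
    by rewrite /far os ot expnS /=; move: szt => /=; lia.
  - move=> g /flattenP[_ /mapP[t tL ->] gN]; apply: contraNN cN => cg.
    apply/(@flattenP _ (s :: L')); exists t => //.
    exact: mem_path_nbhds gN cg.
  - apply: cL'; apply: star_nbhds_center => [|t].
      by rewrite /= take0 !inE eqxx orbT.
    rewrite inE => /orP[/eqP->|tL].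
      by apply: (covers_flatten (s := s)); rewrite ?mem_head //;
        apply: nbhds_head.
    by apply: (covers_flatten (s := t)); rewrite ?inE ?tL ?orbT //;
      apply: nbhds_shrink.
have [L' [uL' hL'] [cL' _]] := front s sL.
move: uL' hL' cL'; case/splitPr: xs => s1 s2 uL' hL' cL' {sL front}.
(* Common end of the cases in which the star survives, with leg [t1] and a detached path [t2]. *)
have fin z t1 t2 : subseq t1 s1 -> subseq t2 s2 -> z \in s1 ++ s2 ->
    {subset take 1 t1 <= take 1 (s1 ++ x :: s2)} ->
    spread k (t1 :: L') ->
    odd (size t2) ==> (2 ^ k <= size t2) ->
    covers (Some z) (nbhds [:: c] (s1 ++ x :: s2) [::])
      (nbhds [:: c] t1 [::] ++ path_nbhds t2) ->
    exists y G, [/\ y != Some x, safe k G, {in G, forall g, x \notin g} &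
      covers y (star_nbhds c L) G].
  move=> ts1 ts2 zs ht h1 h2 hc.
  exists (Some z), (star_nbhds c (t1 :: L') ++ path_nbhds t2).
  have : uniq (x :: t2 ++ (c :: t1 ++ flatten L')).
    have /perm_uniq-> : perm_eq (x :: t2 ++ (c :: t1 ++ flatten L'))
        (c :: (t1 ++ x :: t2) ++ flatten L').
      by apply/permP => p; rewrite /= !count_cat /= !count_cat /=; lia.
    apply: subseq_uniq uL'; rewrite /= eqxx; apply: cat_subseq => //.
    by apply: cat_subseq => //=; rewrite eqxx.
  rewrite cons_uniq mem_cat negb_or cat_uniq => /andP[/andP[x2 x1]].
  case/and3P=> u2 /hasPn t12 u1; split=> //.
  - apply: contraTneq zs => -[->]; move: uL'.
    rewrite cons_uniq cat_uniq => /and4P[_ + _ _].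
    rewrite cat_uniq mem_cat /= !negb_or => /and3P[_ /andP[xs1 _] /andP[xs2 _]].
    by rewrite xs1.
  - apply: safe_cat; [|exact: IHk|].
      move=> e g eN gN a /(mem_star_nbhds eN)/t12; apply: contraNN.
      exact: mem_path_nbhds.
    by apply: safe_path.
  - move=> g; rewrite mem_cat => /orP[/mem_star_nbhds|/mem_path_nbhds] gN.
      by apply: contraNN x1 => /gN.
    by apply: contraNN x2 => /gN.
  - by apply: cL'; apply: star_nbhds_leg.
have := spreadW hL'; have e2k : 2 ^ k.+1 = 2 * 2 ^ k by rewrite expnS.
rewrite /spread !pairwise_cons => /and3P[_ _ fL'].
move: (hL') => /and3P[oL' /allP fs _].
have evenL' t : ~~ odd (size t) -> has (fun s => odd (size s)) L' ->
    spread k (t :: L').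
  move=> et oL; rewrite /spread /= oL orbT fL' andbT /=.
  by apply/allP => u _; rewrite /far (negbTE et).
have alone t : odd (size t) -> ~~ has (fun s => odd (size s)) L' ->
    spread k (t :: L').
  move=> ot /hasPn oL; rewrite /spread /= ot fL' andbT /=.
  by apply/allP => u /oL eu; rewrite /far (negbTE eu) andbF.
have take1 t1 t2 : {subset take 1 t1 <= take 1 (t1 ++ t2)}.
  by move=> b; case: t1 => [//|a t1] /=; rewrite !take0.
have [o1|e1] := boolP (odd (size s1)); have [o2|e2] := boolP (odd (size s2)).
(* Both parts are odd: [s1] stays as an odd leg if it is long enough together with each other odd
   leg. *)
- have [good|] := boolP (all (far k s1) L').
    case: s2 => [//|b s2] in uL' hL' cL' fin o2 oL' fs *.
    apply: (fin b s1 s2);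
      rewrite ?subseq_refl ?subseq_cons ?mem_cat ?mem_head ?orbT //.
    + by rewrite /spread /= o1 good.
    + by move: o2 => /=; lia.
    + exact: nbhds_split_right.
  (* Otherwise [s1] and some odd [t] have together fewer than [2 ^ k] vertices, so [s2] has at least
     [2 ^ k] and may stay odd, while [t] is the odd leg the star needs. *)
  case/allPn=> t tL; rewrite /far negb_imply o1 /= -ltnNge => /andP[ot lt].
  have := fs t tL; rewrite /far ot andbT size_cat /= e2k => hst.
  case/lastP: s1 => [//|s1 a] in uL' hL' cL' fin o1 oL' fs lt hst *.
  rewrite size_rcons /= in o1 lt hst.
  apply: (fin a s1 s2);
    rewrite ?subseq_refl ?subseq_rcons ?mem_cat ?mem_rcons ?mem_head //.
  + by rewrite -cats1 -catA; apply: take1.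
  + by apply: evenL' => //; apply/hasP; exists t.
  + by move: lt hst; lia.
  + exact: nbhds_split_left.
(* Exactly one part is odd, so the whole leg is even and the required odd leg is among the others;
   both parts can be made even. *)
- have {}oL' : has (fun s => odd (size s)) L'.
    by move: oL'; rewrite /= size_cat /= oddD o1 /= (negbTE e2).
  case/lastP: s1 => [//|s1 a] in uL' hL' cL' fin o1 fs *.
  rewrite size_rcons /= in o1.
  apply: (fin a s1 s2);
    rewrite ?subseq_refl ?subseq_rcons ?mem_cat ?mem_rcons ?mem_head //.
  + by rewrite -cats1 -catA; apply: take1.
  + exact: evenL'.
  + by rewrite (negbTE e2).
  + exact: nbhds_split_left.
- have {}oL' : has (fun s => odd (size s)) L'.
    by move: oL'; rewrite /= size_cat /= oddD (negbTE e1) /= o2.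
  case: s2 => [//|b s2] in uL' hL' cL' fin o2 fs *.
  apply: (fin b s1 s2);
    rewrite ?subseq_refl ?subseq_cons ?mem_cat ?mem_head ?orbT //.
  + exact: evenL'.
  + by move: o2 => /=; lia.
  + exact: nbhds_split_right.
(* Both parts are even. If [x] is next to the centre, Dominator takes the centre; this hits the
   neighbourhood of the first vertex of every leg, so [ev] may drop that vertex from each odd leg
   and only even paths remain. *)
case/lastP: s1 => [|s1 a] in uL' hL' cL' fin e1 oL' fs *.
  pose ev t := if odd (size t) then behead t else t.
  have sub_ev M : subseq (flatten (map ev M)) (flatten M).
    elim: M => //= t M IHM; apply: cat_subseq => //; rewrite /ev.
    by case: ifP => // _; case: t => //= a t; apply: subseq_cons.
  exists (Some c), (flatten [seq path_nbhds t | t <- s2 :: map ev L']).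
  move: uL'; rewrite [_ ++ _]/= !cons_uniq inE negb_or.
  case/and3P=> /andP[cx _] xN uL'.
  have sub2 : subseq (flatten (s2 :: map ev L')) (s2 ++ flatten L').
    exact: cat_subseq.
  split=> //.
  - apply: safe_paths; first exact: subseq_uniq uL'.
    rewrite /= (negbTE e2) /=; apply/allP => _ /mapP[t _ ->]; apply/implyP.
    by rewrite /ev; case: ifP => [|-> //]; case: t => //= a t /negbTE->.
  - move=> g /flattenP[_ /mapP[t tL ->] gN]; apply: contraNN xN => xg.
    apply: (mem_subseq sub2); apply/(@flattenP _ (s2 :: _)); exists t => //.
    exact: mem_path_nbhds gN xg.
  - apply: cL'; apply: star_nbhds_center => [|t]; first exact: mem_head.
    rewrite inE => /orP[/eqP->|tL].
      apply: (covers_flatten (s := s2)); first exact: mem_head.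
      move=> e; rewrite [nbhds _ _ _]/= inE => /orP[/eqP->|].
        by left; rewrite /= mem_head.
      exact: nbhds_shrink.
    apply: (covers_flatten (s := ev t)); first by rewrite inE map_f ?orbT.
    rewrite /ev; case: ifP => ot; last exact: nbhds_shrink.
    case: t ot {tL} => //= a t _ e; rewrite inE => /orP[/eqP->|].
      by left; rewrite /= mem_head.
    exact: (@nbhds_shrink (Some c)).
case/lastP: s1 => [//|s1 b] in uL' hL' cL' fin e1 oL' fs *.
rewrite !size_rcons /= negbK in e1.
(* With another odd leg available, two vertices of the inner part are dropped; otherwise only one,
   so that the inner part is the sole odd leg. *)
have [o|o] := boolP (has (fun s => odd (size s)) L').
  apply: (fin a s1 s2); rewrite ?subseq_refl ?mem_cat ?mem_rcons ?mem_head //.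
  + by rewrite -!cats1 -catA; apply: prefix_subseq.
  + by rewrite -!cats1 -!catA; apply: take1.
  + exact: evenL'.
  + by rewrite (negbTE e2).
  + exact: nbhds_split_left2.
apply: (fin a (rcons s1 b) s2);
  rewrite ?subseq_refl ?subseq_rcons ?mem_cat ?mem_rcons ?mem_head //.
+ by rewrite -(cats1 _ a) -catA; apply: take1.
+ by apply: alone; rewrite // size_rcons /= e1.
+ by rewrite (negbTE e2).
+ exact: nbhds_split_left.
Qed.

End Hypergraph.

(** * From hypergraph strategies to the domination game *)

Section Game.

Variable G : simple_graph.
Implicit Types (D S : {set G}) (F : seq (seq G)).

(** Invariant: each closed neighbourhood is hit by Dominator or still contains, outside [S], an edge
    of a safe hypergraph. *)
Lemma safe_staller_loses k D S F :
  D :&: S = set0 -> safe k F ->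
  (forall v : G, closed_nbhd v :&: D != set0 \/
     exists2 g, g \in F & {in g, forall a, a \in closed_nbhd v :\: S}) ->
  ~~ staller_wins_within k D S.
Proof.
elim: k D S F => [|k IHk] D S F //= DS [_ sF] hF.
apply/existsP => -[x /andP[xU]]; have [y yx sy] := sF x.
have hv v : closed_nbhd v :&: D != set0 \/
    (exists2 z, y = Some z & z \in closed_nbhd v :\: S) \/
    exists2 g, g \in play x y F
      & {in g, forall a, a \in closed_nbhd v :\: (x |: S)}.
  have [|[g gF gv]] := hF v; [by left | right].
  have [|yg] := boolP (hit y g).
    by case: y {yx sy} => // z zg; left; exists z => //; apply: gv.
  right; exists (filter (predC1 x) g); first exact: mem_play.
  move=> a; rewrite mem_filter => /andP[/= ax /gv].
  by rewrite !inE negb_or ax.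
case/orP=> [/existsP[v vS]|/andP[/set0Pn[u uU] /forallP hy]].
  have [/set0Pn[w]|[[z yz]|[g gF gv]]] := hv v.
  - rewrite inE => /andP[/(subsetP vS)]; move: xU; rewrite !inE negb_or.
    case/andP=> xD xS /orP[/eqP->|wS wD]; first by rewrite (negbTE xD).
    by have := in_set0 w; rewrite -DS inE wD wS.
  - rewrite inE => /andP[zS /(subsetP vS)];
      rewrite !inE (negbTE zS) orbF => /eqP zx.
    by rewrite yz zx eqxx in yx.
  - case: g gF gv => [|a g] gF gv; first by have := safe_nonempty sy;
      rewrite gF.
    have := gv a (mem_head _ _); rewrite inE => /andP[+ /(subsetP vS)].
    by move/negP.
(* If the hypergraph answer is a pass or an already claimed vertex, Dominator takes an arbitrary
   unclaimed [u]; extra vertices do him no harm. *)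
pose z := if y is Some z then if z \in unclaimed D (x |: S) then z else u else
  u.
have zU : z \in unclaimed D (x |: S).
  by rewrite /z; case: (y) => [w|//]; case: ifP.
have := hy z; rewrite zU /=; apply/negP; apply: IHk sy _ => [|v].
  move: zU xU; rewrite !inE !negb_or => /and3P[zD zx zS] /andP[xD xS].
  apply/setP=> w; have := in_set0 w; rewrite -DS !inE.
  have [->|_] := eqVneq w z; first by rewrite (negbTE zx) (negbTE zS).
  by have [->|] := eqVneq w x; first by rewrite (negbTE xD).
have [/set0Pn[w]|[[w yw wv]|]] := hv v; last by right.
  rewrite inE => /andP[wv wD]; left; apply/set0Pn; exists w.
  by rewrite inE wv in_setU1 wD orbT.
left; apply/set0Pn; exists w.
move: wv; rewrite inE => /andP[wS wN]; rewrite inE wN in_setU1 /=.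
rewrite /z yw; case: ifP => [_|]; first by rewrite eqxx.
have /negbTE wx : w != x by apply: contraNneq yx => <-; rewrite yw.
by rewrite !inE wx (negbTE wS) !orbF => /negbFE->; rewrite orbT.
Qed.

(** * Staller's bisection strategy on a path *)

Section Staller.

Variable f : nat -> G.

(** Even offsets [i - a] are the odd positions counted from 1. Both parts left by Staller's move
    inherit the hypotheses: the vertex separating them is hers, and its odd offset preserves the
    parity of offsets. *)
Lemma staller_wins_interval k a m D S :
  odd m -> m < 2 ^ k ->
  (forall i j, a <= i < a + m -> a <= j < a + m -> f i = f j -> i = j) ->
  (forall i, a <= i < a + m -> f i \in unclaimed D S) ->
  (forall i u, a <= i < a + m -> ~~ odd (i - a) -> u \in closed_nbhd (f i) ->
     u \in S \/ exists j, [/\ u = f j, a <= j < a + m, i <= j.+1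
       & j <= i.+1]) ->
  staller_wins_within k D S.
Proof.
elim: k a m D S => [|k IHk] a m D S om lt_m finj fU fN; first by move: om lt_m;
  case: m fN fU finj.
have [m1|m_gt1] := leqP m 1.
  have {m1} m1 : m = 1 by move: om m1; lia.
  apply/existsP; exists (f a); rewrite fU ?m1 ?addn1 ?leqnn //=.
  apply/orP; left; apply/existsP; exists (f a); apply/subsetP => u.
  have ra : a <= a < a + m by lia.
  case/(fN a u ra); rewrite ?subnn //; first by rewrite inE orbC => ->.
  by case=> j [-> rj _ _]; have -> : j = a by [lia]; rewrite !inE eqxx.
(* [p] is the odd one of [m./2] and [m./2.-1]. In the second case the right part has [m./2.+1]
   vertices, still below [2 ^ k] because [m./2] and [2 ^ k] are both even. *)
have [p [op p1 p2 pm]] : exists p, [/\ odd p, p < 2 ^ k, m - p.+1 < 2 ^ k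
  & p.+1 < m].
  rewrite expnS in lt_m.
  have ek : ~~ odd (2 ^ k) by case: (k) lt_m => [|k']; [rewrite expn0;
    lia | rewrite expnS; lia].
  have [o|e] := boolP (odd m./2); [exists m./2 | exists m./2.-1]; split; lia.
have rx : a <= a + p < a + m by lia.
apply/existsP; exists (f (a + p)); rewrite fU //=; apply/orP; right.
have sub i : a <= i < a + m -> i != a + p ->
  f i \in unclaimed D (f (a + p) |: S).
  move=> ri ip; have := fU i ri; rewrite !inE !negb_or => /andP[-> ->].
  by rewrite andbT /=; apply: contraNneq ip => /finj->.
apply/andP; split.
  by apply/set0Pn; exists (f a); apply: sub; lia.
apply/forallP => y; apply/implyP => yU.
have fin b q : odd q -> q < 2 ^ k -> a <= b -> b + q <= a + m ->
   (b + q = a + p) \/ (b = (a + p).+1 /\ b + q = a + m) ->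
   (forall i, b <= i < b + q -> f i != y) -> b = a \/ b = (a + p).+1 ->
   staller_wins_within k (y |: D) (f (a + p) |: S).
  move=> oq ltq ab bq hb fy hb'; apply: (IHk b q) => //.
  - by move=> i j ri rj; apply: finj; lia.
  - move=> i ri; have : f i \in unclaimed D (f (a + p) |: S).
      by apply: sub; lia.
    by rewrite !inE !negb_or fy.
  - move=> i u ri ei uN.
    have ri' : a <= i < a + m by lia.
    have ei' : ~~ odd (i - a) by lia.
    have [uS|[j [uj rj ij ji]]] := fN i u ri' ei' uN.
      by left; rewrite inE uS orbT.
    have [jp|jp] := eqVneq j (a + p); first by left; rewrite uj jp !inE eqxx.
    by right; exists j; split=> //; lia.
(* Staller goes on in the right part if Dominator answered in the left one, and in the left part
   otherwise. *)
have [/existsP[i /eqP yi]|/existsPn ny] := boolP [exists i : 'I_p, y == f (a +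
  i)].
  apply: (fin (a + p).+1 (m - p.+1)) => //; try lia.
  move=> j rj; apply/eqP; rewrite yi => /finj; have := ltn_ord i; lia.
apply: (fin a p) => //; try lia.
move=> j rj; have jp : j - a < p by lia.
by have := ny (Ordinal jp); rewrite /= subnKC 1?eq_sym //; lia.
Qed.

End Staller.
End Game.

(** * Vertices and neighbourhoods of the subdivided star *)

Lemma path_nbhd_mem (T : eqType) (r : rel T) c s v :
  symmetric r -> path r c s -> v \in s ->
  exists2 g, g \in nbhds [:: c] s [::] & {in g, forall a, a = v \/ r v a}.
Proof.
move=> rC; elim: s c => //= b s IHs c /andP[cb bs].
rewrite inE => /predU1P[->|vs].
  exists [:: c, b & take 1 (s ++ [::])]; first exact: mem_head.
  move=> a; rewrite !inE => /or3P[/eqP->|/eqP->|]; [by right;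
    rewrite rC | by left |].
  case: s bs {IHs} => //= d s /andP[bd _]; rewrite take0 inE => /eqP->.
  by right.
have [g gN gv] := IHs b bs vs; exists g => //.
by rewrite inE gN orbT.
Qed.

Section SubdividedStar.

Variables (l : nat) (n : 'I_l -> nat).

Local Notation star := (subdivided_star n).

(* [None] is also the junk value outside the leg. *)
Definition leg_vertex (i : 'I_l) (j : nat) : star :=
  omap (fun o : 'I_(n i) => Tagged (fun i => 'I_(n i)) o) (insub j).

Definition leg (i : 'I_l) : seq star :=
  [seq leg_vertex i j | j <- iota 0 (n i)].

Lemma leg_vertexE i (j : 'I_(n i)) :
  leg_vertex i j = Some (Tagged (fun i => 'I_(n i)) j).
Proof. by rewrite /leg_vertex valK. Qed.

Lemma leg_vertexP i j (lt_j : j < n i) :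
  leg_vertex i j = Some (Tagged (fun i => 'I_(n i)) (Ordinal lt_j)).
Proof. by rewrite -leg_vertexE. Qed.

Lemma adj_leg0 i : 0 < n i -> adj (None : star) (leg_vertex i 0).
Proof. by move=> lt0; rewrite (leg_vertexP lt0). Qed.

Lemma adj_legS i j : j.+1 < n i -> adj (leg_vertex i j) (leg_vertex i j.+1).
Proof.
by move=> ltj; rewrite (leg_vertexP ltj) (leg_vertexP (ltnW ltj)) /= !eqxx.
Qed.

Lemma leg_vertex_inj i i' j j' : j < n i -> j' < n i' ->
  leg_vertex i j = leg_vertex i' j' -> i = i' /\ j = j'.
Proof.
move=> ltj ltj' /(congr1 (omap (fun p : {i
  & 'I_(n i)} => (tag p, val (tagged p))))).
by rewrite (leg_vertexP ltj) (leg_vertexP ltj') /= => -[-> ->].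
Qed.

Lemma adj_leg_vertex i j (u : star) : j < n i -> adj (leg_vertex i j) u ->
  [\/ u = None /\ j = 0, j.+1 < n i /\ u = leg_vertex i j.+1 |
      0 < j /\ u = leg_vertex i j.-1].
Proof.
move=> ltj; rewrite (leg_vertexP ltj); case: u => [[i' j']|] /=; last first.
  by move/eqP->; apply: Or31.
case/andP=> /eqP ii; subst i' => /orP[]/eqP jj; rewrite -leg_vertexE.
  by apply: Or32; rewrite jj ltn_ord.
by apply: Or33; rewrite -jj.
Qed.

Lemma path_leg i : 0 < n i -> path (@adj star) None (leg i).
Proof.
move=> n0; apply/(pathP None) => j; rewrite size_map size_iota => ltj.
rewrite (nth_map 0) ?size_iota // nth_iota //.
case: j ltj => [|j] ltj /=; first exact: adj_leg0.
by rewrite (nth_map 0) ?size_iota ?nth_iota 1?ltnW // add0n; apply: adj_legS.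
Qed.

Lemma leg_vertex_surj (u : star) :
  u = None \/ exists i j, j < n i /\ u = leg_vertex i j.
Proof.
case: u => [[i j]|]; [right | by left].
by exists i, j; rewrite ltn_ord leg_vertexE.
Qed.

Definition legs : seq (seq star) := [seq leg i | i <- enum 'I_l].

Lemma size_leg i : size (leg i) = n i.
Proof. by rewrite size_map size_iota. Qed.

Lemma mem_legP i (u : star) :
  reflect (exists2 j, j < n i & u = leg_vertex i j) (u \in leg i).
Proof.
apply: (iffP mapP) => -[j]; rewrite ?mem_iota ?add0n => jn ->; exists j => //.
by rewrite mem_iota.
Qed.

Lemma uniq_legs : uniq (None :: flatten legs).
Proof.
rewrite cons_uniq; apply/andP; split.
  apply/flattenP => -[_ /mapP[i _ ->] /mem_legP[j jn]].
  by rewrite (leg_vertexP jn).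
rewrite /legs; elim: (enum 'I_l) (enum_uniq 'I_l) => //= i I IHI /andP[iI uI].
rewrite cat_uniq IHI // andbT; apply/andP; split.
  rewrite map_inj_in_uniq ?iota_uniq // => j j';
    rewrite !mem_iota /= !add0n => jn jn'.
  by case/(leg_vertex_inj jn jn').
apply/hasPn => u /flattenP[_ /mapP[i' iI' ->] /mem_legP[j' jn' ->]].
apply/negP => /mem_legP[j jn /(leg_vertex_inj jn' jn)[ii _]].
by rewrite ii (negbTE iI) in iI'.
Qed.

(** Inclusion suffices for the lower bound, since smaller edges only help Staller. *)
Lemma star_nbhds_closed (v : star) : (forall i, 0 < n i) ->
  exists2 g, g \in star_nbhds None legs & {subset g <= closed_nbhd v}.
Proof.
move=> npos; have [->|[i [j [jn vE]]]] := leg_vertex_surj v.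
  exists (None :: flatten [seq take 1 s | s <- legs]); first exact: mem_head.
  move=> u; rewrite !inE => /predU1P[->|]; first by rewrite eqxx.
  case/flattenP=> _ /mapP[_ /mapP[i _ ->] ->].
  rewrite /leg; case: (n i) (npos i) (@adj_leg0 i) => //= m _ a0.
  by rewrite take0 inE => /eqP->; rewrite a0 ?orbT.
have vi : v \in leg i by apply/mem_legP; exists j.
have [g gN gv] := path_nbhd_mem (@adj_sym star) (path_leg (npos i)) vi.
exists g.
  rewrite inE; apply/orP; right; apply/flattenP.
  exists (nbhds [:: None] (leg i) [::]) => //.
  by do 2!apply: map_f; rewrite mem_enum.
by move=> a /gv[->|va]; rewrite inE ?eqxx ?va ?orbT.
Qed.

(** * The two bounds for the subdivided star *)

Lemma staller_needs_moves k : (forall i, 0 < n i) ->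
  (exists i, odd (n i)) ->
  (forall i j, i != j -> odd (n i) -> odd (n j) -> 2 ^ k <= n i + n j) ->
  ~~ staller_wins_within k (set0 : {set star}) set0.
Proof.
move=> npos [i0 odd0] far_n.
apply: (@safe_staller_loses star k set0 set0 (star_nbhds None legs)).
- by rewrite setI0.
- apply: safe_star; first exact: uniq_legs.
  apply/andP; split.
    by apply/hasP; exists (leg i0); rewrite ?size_leg // map_f ?mem_enum.
  rewrite pairwise_map; have := enum_uniq 'I_l; rewrite uniq_pairwise.
  apply: sub_pairwise => i j ij; rewrite /= /far !size_leg.
  by apply/implyP => /andP[]; apply: far_n.
- move=> v; right; have [g gN gv] := star_nbhds_closed v npos.
  by exists g => // a /gv; rewrite setD0.
Qed.

(* The path with [n i1 + n i2 + 1] vertices through the centre, starting at the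
   leaf of leg [i1]. *)
Definition through_path (i1 i2 : 'I_l) (p : nat) : star :=
  if p < n i1 then leg_vertex i1 (n i1 - p.+1)
  else if p == n i1 then None else leg_vertex i2 (p - (n i1).+1).

Lemma staller_wins_through_path k i1 i2 :
  i1 != i2 -> odd (n i1) -> odd (n i2) -> n i1 + n i2 + 1 < 2 ^ k ->
  staller_wins_within k (set0 : {set star}) set0.
Proof.
move=> i12 o1 o2 ltk; pose f := through_path i1 i2.
apply: (@staller_wins_interval star f k 0 (n i1 + n i2 + 1)) => //.
- by rewrite addn1 /= oddD o1 o2.
- move=> i j; rewrite add0n /= => ri rj; rewrite /f /through_path.
  have n12 p q : p < n i1 -> q < n i2 -> leg_vertex i1 p <> leg_vertex i2 q.
    by move=> lp lq /(leg_vertex_inj lp lq)[/eqP]; rewrite (negbTE i12).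
  have nN t p : p < n t -> leg_vertex t p <> None.
    by move=> lp; rewrite (leg_vertexP lp).
  case: (ltngtP i (n i1)) => hi; case: (ltngtP j (n i1)) => hj.
  + by case/leg_vertex_inj; lia.
  + by move/n12; case; lia.
  + by move/nN; case; lia.
  + by move/esym/n12; case; lia.
  + by case/leg_vertex_inj; lia.
  + by move/nN; case; lia.
  + by move/esym/nN; case; lia.
  + by move/esym/nN; case; lia.
  + by rewrite hi hj.
- by move=> i _; rewrite !inE.
- move=> i u; rewrite subn0 add0n /= => ri ei; rewrite inE => uN; right.
  have [uE|{}uN] := predU1P uN; first by exists i; split=> //; lia.
  (* [i] is even and [n i1] is odd, so [f i] is not the centre, the only vertex of the path that may
     have neighbours off it. *)
  move: uN; rewrite {1}/f /through_path; case: (ltngtP i (n i1)) => hi;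
    last by lia.
    case/adj_leg_vertex; first lia.
    + case=> -> h; exists (n i1); rewrite /f /through_path ltnn eqxx;
        split=> //; lia.
    + case=> h ->; exists i.-1; rewrite /f /through_path.
      have -> : i.-1 < n i1 by lia.
      by split; [congr leg_vertex | ..]; lia.
    + case=> h ->; exists i.+1; rewrite /f /through_path.
      have -> : i.+1 < n i1 by lia.
      by split; [congr leg_vertex | ..]; lia.
  case/adj_leg_vertex; first lia.
  + case=> -> h; exists (n i1); rewrite /f /through_path ltnn eqxx; split=> //;
      lia.
  + case=> h ->; exists i.+1; rewrite /f /through_path.
    have -> : (i.+1 < n i1) = false by lia.
    have -> : (i.+1 == n i1) = false by lia.
    by split; [congr leg_vertex | ..]; lia.
  + case=> h ->; exists i.-1; rewrite /f /through_path.
    have -> : (i.-1 < n i1) = false by lia.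
    have -> : (i.-1 == n i1) = false by lia.
    by split; [congr leg_vertex | ..]; lia.
Qed.

End SubdividedStar.

Theorem theorem18 (l : nat) (n : 'I_l -> nat) (i1 i2 : 'I_l)
  (hl : 2 <= l)
  (npos : forall i : 'I_l, 0 < n i)
  (i12 : i1 != i2)
  (odd1 : odd (n i1)) (odd2 : odd (n i2))
  (smallest : forall j : 'I_l, j != i1 -> j != i2 -> odd (n j) ->
     n i1 <= n j /\ n i2 <= n j) :
  gammaSMB' (subdivided_star n) = Some (up_log 2 (n i1 + n i2 + 1)).
Proof.
have m_gt1 : 1 < n i1 + n i2 + 1 by rewrite addn1 ltnS addn_gt0 npos.
apply/gammaSMB'_Some; split=> [|k].
  apply: (staller_wins_through_path i12) => //.
  (* This bound is not strict, but the number of vertices is odd while a power of two with positive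
     exponent is even. *)
  have := up_logP (n i1 + n i2 + 1) (isT : 1 < 2).
  case: (up_log _ _) => [|k]; first by rewrite expn0 leqNgt m_gt1.
  by rewrite expnS; lia.
apply: contraTT; rewrite -ltnNge => ltk; apply: staller_needs_moves => //.
  by exists i1.
have le_k : 2 ^ k <= n i1 + n i2.
  rewrite leqNgt; apply: contraTN ltk => lt_k.
  by rewrite -leqNgt up_log_min // addn1.
(* It remains to see that no two distinct odd legs are together shorter than [i1] and [i2]; the
   cases record which of the two legs are among these. *)
move=> i j ij oi oj; apply: leq_trans le_k _.
have [ei|i_1] := eqVneq i i1; have [ej|j_1] := eqVneq j i1; subst;
  rewrite ?eqxx // in ij *.
- have [->//|j_2] := eqVneq j i2; have [] := smallest j j_1 j_2 oj; lia.
- have [->|i_2] := eqVneq i i2; first by rewrite addnC.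
  have [] := smallest i i_1 i_2 oi; lia.
- have [ei|i_2] := eqVneq i i2; have [ej|j_2] := eqVneq j i2; subst.
  + by rewrite eqxx in ij.
  + by have [] := smallest j j_1 j_2 oj; lia.
  + by have [] := smallest i i_1 i_2 oi; lia.
  + by have [? _] := smallest i i_1 i_2 oi;
      have [_ ?] := smallest j j_1 j_2 oj; lia.
Qed.
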